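(* Let $(W,S)$ be a Coxeter system with $S$ finite. For $k \geq 0$ let $W^{CFC}_k$ denote the set of cyclically fully commutative elements of $W$ of Coxeter length $k$. Then the generating series $W^{CFC}(x) := \sum_{k \geq 0} |W^{CFC}_k|\, x^k$ is a rational function of $x$.
   Context: A Coxeter system $(W,S)$ consists of a group $W$ generated by a finite set $S$ of involutions subject to the relations $(st)^{m_{st}}=1$ for $s \neq t$ with $m_{st} \in \{2,3,\ldots\}\cup\{\infty\}$ (no relation if $m_{st}=\infty$). Words in the free monoid $S^*$ are called expressions. The Coxeter length $\ell(w)$ is the minimal length of an expression representing $w$; expressions of that length are reduced expressions, and $R(w)$ denotes the set of reduced expressions of $w$. For $m_{st}=2$ the relation $st=ts$ is a commutation relation. An element $w$ is fully commutative (FC) if any two words of $R(w)$ can be linked by a sequence of commutation relations (swapping adjacent letters $s,t$ with $m_{st}=2$). A cyclic shift of a word $s_1\cdots s_n$ is any word $s_k s_{k+1}\cdots s_n s_1 \cdots s_{k-1}$ for $k\in\{1,\ldots,n\}$. An element $w \in W$ is cyclically fully commutative (CFC) if every cyclic shift of every word in $R(w)$ is a reduced expression of some fully commutative element (possibly different from $w$). *)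

(* Defs.v *)
From mathcomp Require Import all_boot all_algebra.
From mathcomp Require Import boolp.
Set Implicit Arguments. Unset Strict Implicit. Unset Printing Implicit Defensive.

Section Coxeter.
Variable S : finType.
(* Coxeter matrix: [m s t] is m_{st} for s <> t, with the convention that
   [m s t = 0] encodes m_{st} = infinity.  The diagonal is irrelevant. *)
Variable m : S -> S -> nat.

Definition coxeter_matrix : Prop :=
  (forall s t, m s t = m t s) /\ (forall s t, s != t -> m s t != 1%N).

Fixpoint alt (s t : S) (n : nat) : seq S :=
  if n is n'.+1 then s :: alt t s n' else [::].

(* Equality in W: the congruence on the free monoid S^* generated by
   s s = 1 and the braid relations (s t s ...)_{m_st} = (t s t ...)_{m_st};
   this monoid quotient is exactly the group presented by
   <S | s^2 = 1, (st)^{m_st} = 1>. *)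
Inductive wequiv : seq S -> seq S -> Prop :=
| we_refl u : wequiv u u
| we_sym u v : wequiv u v -> wequiv v u
| we_trans u v w : wequiv u v -> wequiv v w -> wequiv u w
| we_ctx a b u v : wequiv u v -> wequiv (a ++ u ++ b) (a ++ v ++ b)
| we_inv s : wequiv [:: s; s] [::]
| we_braid s t : s != t -> (0 < m s t)%N ->
    wequiv (alt s t (m s t)) (alt t s (m s t)).

Inductive cequiv : seq S -> seq S -> Prop :=
| ce_refl u : cequiv u u
| ce_sym u v : cequiv u v -> cequiv v u
| ce_trans u v w : cequiv u v -> cequiv v w -> cequiv u w
| ce_swap a b s t : s != t -> m s t = 2%N ->
    cequiv (a ++ [:: s; t] ++ b) (a ++ [:: t; s] ++ b).

Definition reduced (u : seq S) : Prop :=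
  forall v, wequiv u v -> (size u <= size v)%N.

Definition FC (u : seq S) : Prop :=
  forall v1 v2, reduced v1 -> reduced v2 -> wequiv u v1 -> wequiv u v2 ->
    cequiv v1 v2.

Definition CFC (u : seq S) : Prop :=
  forall v, reduced v -> wequiv u v ->
    forall k, reduced (rot k v) /\ FC (rot k v).

Definition cfc_count (k : nat) : nat :=
  #|[set [set v : k.-tuple S | `[< wequiv (val u) (val v) >]]
     | u in [set u : k.-tuple S | `[< reduced (val u) /\ CFC (val u) >]]]|.

End Coxeter.

(* Main.v *)
(* Let d(s,t) be the order of st in W.  Counting reflections with parity gives
   the exchange property, and hence: a word is reduced and fully commutative
   iff no word of its commutation class contains a factor ss or a factor
   (sts...) of length d(s,t), except for the factors st with m_st = 2.  So u is
   CFC iff there is no factorisation u = xy in the trace monoid (words modulo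
   commutations) such that yx contains one of these finitely many factors.
   A set of traces is recognizable when it is saturated by a congruence of
   finite index.  By Levi's lemma for traces, the set of pairs of classes of
   (x, y) over all factorisations u = xy is again a congruence of finite index,
   so recognizable sets are stable under products and under u = xy |-> yx, and
   the CFC elements are recognizable.  Choosing recursively the first letter of
   each trace gives a normal form that can also be tested by a finite
   congruence; the number of normal words of length k is therefore given by
   powers of a transfer matrix, and Cayley-Hamilton yields a linear
   recurrence. *)
Require Import Defs.
From Stdlib Require Import Setoid Morphisms.
From mathcomp Require Import all_boot all_algebra.
From mathcomp Require Import boolp.
From mathcomp Require Import zify.
Import GRing.Theory.
Set Implicit Arguments. Unset Strict Implicit. Unset Printing Implicit Defensive.

(** * The exchange property *)

Lemma alt_rcons (S : finType) (s t : S) n :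
  alt s t n.+1 = rcons (alt s t n) (if odd n then t else s).
Proof.
elim: n s t => // n IH s t; rewrite -[LHS]/(s :: alt t s n.+1) IH /=.
by rewrite if_neg.
Qed.

Lemma size_alt (S : finType) (s t : S) n : size (alt s t n) = n.
Proof. by elim: n s t => //= n IH s t; rewrite IH. Qed.

Lemma take_alt (S : finType) (s t : S) n k : take n (alt s t (n + k)) = alt s t n.
Proof. by elim: n s t => [|n IH] s t; rewrite ?take0 //= IH. Qed.

Section Group.
Variables (S : finType) (m : S -> S -> nat).
Implicit Types (s t : S) (u v w x y : seq S).
Local Notation "u =w v" := (wequiv m u v) (at level 70).
Local Notation reduced := (reduced m).

#[local] Hint Resolve we_refl : core.

#[local] Instance wequiv_equivalence : Equivalence (wequiv m).
Proof.
by split; [exact: we_refl | move=> ? ? /we_sym | exact: we_trans].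
Qed.

#[local] Instance cat_wequiv :
  Proper (wequiv m ==> wequiv m ==> wequiv m) (@cat S).
Proof.
move=> u u' uu' v v' vv'; apply: (we_trans (v := u' ++ v)).
  exact: (@we_ctx _ _ [::] v).
by move: (we_ctx u' [::] vv'); rewrite !cats0.
Qed.

#[local] Instance cons_wequiv :
  Proper (eq ==> wequiv m ==> wequiv m) (@cons S).
Proof. by move=> s _ <- u v uv; rewrite -(cat1s s u) -(cat1s s v) uv. Qed.

#[local] Instance rcons_wequiv :
  Proper (wequiv m ==> eq ==> wequiv m) (@rcons S).
Proof. by move=> u v uv s _ <-; rewrite -(cats1 u) -(cats1 v) uv. Qed.

Lemma wequiv_invol s u : s :: s :: u =w u.
Proof. exact: (we_ctx [::] u (we_inv m s)). Qed.

Lemma wequiv_revK u : rev u ++ u =w [::].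
Proof.
by elim: u => // s u IH; rewrite rev_cons cat_rcons wequiv_invol.
Qed.

Lemma wequiv_Krev u : u ++ rev u =w [::].
Proof. by rewrite -{1}(revK u) wequiv_revK. Qed.

Lemma wequiv_cat2l a u v : a ++ u =w a ++ v <-> u =w v.
Proof.
split=> [e|->//]; rewrite -(cat0s u) -(cat0s v) -(wequiv_revK a) -!catA.
by rewrite e.
Qed.

Lemma wequiv_cat2r a u v : u ++ a =w v ++ a <-> u =w v.
Proof.
split=> [e|->//]; rewrite -(cats0 u) -(cats0 v) -(wequiv_Krev a) !catA.
by rewrite e.
Qed.

Lemma wequiv_cons2 s u v : s :: u =w s :: v <-> u =w v.
Proof. exact: (wequiv_cat2l [:: s]). Qed.

Lemma wequiv_rcons2 s u v : rcons u s =w rcons v s <-> u =w v.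
Proof. by rewrite -!cats1 wequiv_cat2r. Qed.

Lemma wequiv_consl s u v : s :: u =w v <-> u =w s :: v.
Proof. by rewrite -(wequiv_cons2 s u) wequiv_invol. Qed.

Lemma wequiv_rconsl s u v : rcons u s =w v <-> u =w rcons v s.
Proof.
rewrite -(wequiv_rcons2 s (rcons u s)).
suff -> : rcons (rcons u s) s =w u by [].
by rewrite -2!cats1 -catA /= (we_inv m s) cats0.
Qed.

Lemma wequiv_rev u v : u =w v -> rev u =w rev v.
Proof.
move=> uv; rewrite -(cats0 (rev u)) -(wequiv_Krev v) -{1}uv catA.
by rewrite wequiv_revK.
Qed.

(* The parity of the number of letters of [u = s_1 .. s_k] whose reflection
   [s_1 .. s_(i-1) s_i s_(i-1) .. s_1] equals [r] in the group. *)
Fixpoint refl_parity u (r : seq S) : bool :=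
  if u is s :: u' then `[< r =w [:: s] >] (+) refl_parity u' (s :: rcons r s)
  else false.

Lemma refl_parityW u (r r' : seq S) :
  r =w r' -> refl_parity u r = refl_parity u r'.
Proof.
elim: u r r' => //= s u IH r r' rr'; congr (_ (+) _).
  by apply: asbool_equiv_eq; rewrite rr'.
by apply: IH; rewrite rr'.
Qed.

Lemma refl_parity_cat u v (r : seq S) :
  refl_parity (u ++ v) r = refl_parity u r (+) refl_parity v (rev u ++ r ++ u).
Proof.
elim: u r => [|s u IH] r /=; first by rewrite cats0.
by rewrite IH addbA rev_cons !cat_rcons /= -cats1 -!catA.
Qed.

(** The letter with index [i], counted from 0, has as its reflection the palindrome [s t s ...] of
    length [2i+1]. *)
Lemma refl_parity_alt s t n (r : seq S) : refl_parity (alt s t n) r =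
  \big[addb/false]_(i < n) `[< r =w alt s t i.*2.+1 >].
Proof.
elim: n s t r => [|n IH] s t r; first by rewrite big_ord0.
rewrite big_ord_recl [LHS]/= IH; congr (_ (+) _).
apply: eq_bigr => i _; apply: asbool_equiv_eq.
rewrite wequiv_consl wequiv_rconsl (_ : (lift ord0 i).*2.+1 = i.*2.+3) //.
by rewrite (alt_rcons s t i.*2.+2) /= odd_double.
Qed.

(** Each step moves the last letter of the left word to the right word, where by parity it continues
    the alternation. *)
Lemma alt_conj s t n : alt s t n =w alt t s n -> forall k, k <= n ->
  alt s t (n - k) =w alt t s (n + k).
Proof.
move=> e; elim=> [|k IH] kn; first by rewrite subn0 addn0.
have := IH (ltnW kn); rewrite addnS alt_rcons.
rewrite (_ : n - k = (n - k.+1).+1) ?alt_rcons; last by lia.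
rewrite wequiv_rconsl => ->.
suff -> : (if odd (n - k.+1) then t else s) = (if odd (n + k) then s else t).
  by [].
have -> : odd (n + k) = ~~ odd (n - k.+1) by lia.
by case: odd.
Qed.

Lemma alt_odd_rev s t n : alt s t n =w alt t s n -> forall i, i < n ->
  alt s t i.*2.+1 =w alt t s (n - i.+1).*2.+1.
Proof.
move=> e i i_n; case: (leqP i.*2.+1 n) => [le|lt].
  have -> : i.*2.+1 = n - (n - i.*2.+1) by lia.
  have -> : (n - i.+1).*2.+1 = n + (n - i.*2.+1) by lia.
  by apply: alt_conj => //; lia.
apply: we_sym; have -> : i.*2.+1 = n + (i.*2.+1 - n) by lia.
have -> : (n - i.+1).*2.+1 = n - (i.*2.+1 - n) by lia.
by apply: alt_conj; [exact: we_sym | lia].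
Qed.

(** The word [s s] counts the reflection [s] twice, and the two sides of a braid relation list the
    same reflections in reverse order. So the parity is an invariant of the group element. *)
Lemma wequiv_refl_parity u v : u =w v -> refl_parity u =1 refl_parity v.
Proof.
elim=> {u v} //.
- by move=> u v _ IH t; rewrite IH.
- by move=> u v w _ IH1 _ IH2 t; rewrite IH1 IH2.
- move=> a b u v uv IH t; rewrite !refl_parity_cat IH; congr (_ (+) (_ (+) _)).
  by apply: refl_parityW; apply: cat_wequiv; [exact: wequiv_rev | rewrite uv].
- move=> s r /=; rewrite addbF (_ : `[< s :: _ =w _ >] = `[< r =w [:: s] >]).
    exact: addbb.
  apply: asbool_equiv_eq; rewrite wequiv_consl wequiv_rconsl /=.
  by rewrite wequiv_invol.
- move=> s t st m0 r; rewrite !refl_parity_alt.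
  rewrite [RHS](reindex_inj rev_ord_inj); apply: eq_bigr => i _.
  apply: asbool_equiv_eq; rewrite (alt_odd_rev _ (ltn_ord i)) //; exact: we_braid.
Qed.

(** Odd parity forces some letter to have reflection [r], and multiplying by that reflection cancels
    the letter. *)
Lemma refl_parity_deletion u (r : seq S) : refl_parity u r ->
  exists u1 c u2, u = u1 ++ c :: u2 /\ r ++ u =w u1 ++ u2.
Proof.
elim: u r => //= s u IH r; case: asboolP => [e _|_ /= /IH].
  by exists [::], s, u; split=> //=; rewrite e /= wequiv_invol.
move=> [u1 [c [u2 [-> e]]]]; exists (s :: u1), c, u2; split=> //.
by move: e; rewrite cat_cons wequiv_consl cat_rcons.
Qed.

Lemma reduced_repr u : exists2 v, u =w v & reduced v.
Proof.
pose P n := `[< exists2 v, u =w v & size v = n >].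
have exP : exists n, P n by exists (size u); apply/asboolP; exists u.
case: (ex_minnP exP) => n /asboolP[v uv <-] min; exists v => // v' vv'.
by apply: min; apply/asboolP; exists v' => //; rewrite uv.
Qed.

Lemma exchange s u : reduced u -> ~ reduced (s :: u) ->
  exists u1 c u2, u = u1 ++ c :: u2 /\ s :: u =w u1 ++ u2.
Proof.
move=> red_u nred; have [v sv red_v] := reduced_repr (s :: u).
have size_v : size v <= size u.
  rewrite leqNgt; apply/negP => lt; apply: nred => w e.
  by apply: (leq_trans lt); apply: red_v; rewrite -sv.
(* Compare parities at the reflection [s], which the first letter of [s :: u] counts once. If [u]
   has odd parity, a letter of [u] can be deleted; otherwise [v] has, and deleting a letter of [v]
   gives a word for [u] shorter than [u]. *)
have := wequiv_refl_parity sv [:: s]; rewrite /=.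
rewrite (_ : `[< _ >] = true) ?asboolT // (@refl_parityW u _ [:: s]); last first.
  exact: wequiv_invol.
case E: (refl_parity u _) => [|].
  by have [u1 [c [u2 [-> e]]]] := refl_parity_deletion E => _; exists u1, c, u2.
move/esym/refl_parity_deletion => [v1 [c [v2 [ev e]]]].
have uv : u =w v1 ++ v2 by rewrite -e -sv /= wequiv_invol.
by have := red_u _ uv; move: size_v; rewrite ev !size_cat /=; lia.
Qed.

(** * Two left descents and their alternating prefix *)

Lemma reduced_eqsize u v : reduced u -> u =w v -> size u = size v -> reduced v.
Proof. by move=> red uv e w vw; rewrite -e; apply: red; rewrite uv. Qed.

Lemma reduced_cons s u : reduced (s :: u) -> reduced u.
Proof. by move=> red v uv; apply: (red (s :: v)); rewrite uv. Qed.

(* The order of [st] in the group, [0] if infinite.  It could a priori be a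
   proper divisor of [m s t]. *)
Definition braid_order s t : nat :=
  if pselect (exists n, (0 < n) && `[< alt s t n =w alt t s n >]) is left e
  then ex_minn e else 0.

Lemma braid_orderP s t n : 0 < n -> alt s t n =w alt t s n ->
  [/\ 0 < braid_order s t, braid_order s t <= n
    & alt s t (braid_order s t) =w alt t s (braid_order s t)].
Proof.
move=> n0 e; rewrite /braid_order; case: pselect => [ex|[]]; last first.
  by exists n; rewrite n0; apply/asboolP.
case: ex_minnP => d /andP[d0 /asboolP de] min; split=> //.
by apply: min; rewrite n0; apply/asboolP.
Qed.

Lemma braid_order_braid s t : 0 < braid_order s t ->
  alt s t (braid_order s t) =w alt t s (braid_order s t).
Proof.
rewrite /braid_order; case: pselect => [ex|//].
by case: ex_minnP => d /andP[d0 /asboolP de] min.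
Qed.

(** Both [s] and [t] are left descents of [u]. The one that does not start the current alternating
    prefix can be exchanged into [u], which lengthens the prefix until a braid equality
    intervenes. *)
Lemma descents_alt s t u u' v' : reduced u ->
    u =w s :: u' -> size u = (size u').+1 ->
    u =w t :: v' -> size u = (size v').+1 -> forall n,
    (forall q, 0 < q <= n -> ~ alt s t q =w alt t s q) ->
  exists x, (u =w alt s t n.+1 ++ x \/ u =w alt t s n.+1 ++ x) /\
    size u = n.+1 + size x.
Proof.
move=> red_u us su ut st; elim=> [|n IH] H.
  by exists u'; split; [left|rewrite su].
have {IH} [q /andP[q0 qn]|x [ux sx]] := IH; first by apply: H; lia.
have [a [b [e ua shift]]] : exists a b, [/\ u =w alt a b n.+1 ++ x,
    ~ reduced (b :: u) &
    (a, b) = (s, t) \/ (a, b) = (t, s)].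
  case: ux => e; [exists s, t|exists t, s]; split=> //; try by [left|right].
    have tu : t :: u =w v' by rewrite ut wequiv_invol.
    by move=> red; have := red _ tu => /=; lia.
  have su' : s :: u =w u' by rewrite us wequiv_invol.
  by move=> red; have := red _ su' => /=; lia.
have red_y : reduced (alt a b n.+1 ++ x).
  by apply: (reduced_eqsize red_u e); rewrite size_cat size_alt.
have nred_y : ~ reduced (b :: alt a b n.+1 ++ x).
  move=> red_by; apply: ua; apply: (reduced_eqsize red_by); first by rewrite e.
  by rewrite /= size_cat /= size_alt sx.
have Hab q : 0 < q <= n.+1 -> ~ alt b a q =w alt a b q.
  by move=> /H Hq; case: shift Hq => -[-> ->] Hq // /we_sym.
have [u1 [c [u2 [ey eb]]]] := exchange red_y nred_y.
(* Deleting a letter of [x] lengthens the prefix. Deleting a letter inside the prefix yields, after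
   cancelling what follows it, a braid equality of length [(size u1).+1], which is excluded. *)
case: (leqP n.+1 (size u1)) => [le|lt].
  have e1 : u1 = alt a b n.+1 ++ drop n.+1 u1.
    rewrite -{1}(cat_take_drop n.+1 u1); congr (_ ++ _).
    have := congr1 (take n.+1) ey; rewrite !take_cat size_alt ltnn subnn take0 cats0.
    case: ltnP => [lt -> //|ge ->].
    have -> : n.+1 - size u1 = 0 by lia.
    by rewrite take0 cats0 take_oversize.
  exists (drop n.+1 u1 ++ u2); split; last first.
    by have := congr1 size ey; rewrite sx !size_cat size_alt size_drop /=; lia.
  have : u =w alt b a n.+2 ++ drop n.+1 u1 ++ u2.
    rewrite -cat1s in eb.
    by rewrite e [alt b a _]/= cat_cons -wequiv_consl catA -e1 -eb.
  by case: shift => -[-> ->]; [right|left].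
have eu2 : alt a b n.+1 = u1 ++ c :: take (n - size u1) u2.
  have := congr1 (take n.+1) ey; rewrite !take_cat size_alt ltnn subnn take0 cats0.
  rewrite ltnNge (ltnW lt) /= => ->; congr (_ ++ _).
  by rewrite (_ : n.+1 - size u1 = (n - size u1).+1) //; lia.
have ex : u2 = take (n - size u1) u2 ++ x.
  move: ey; rewrite eu2 -catA => /eqP.
  by rewrite eqseq_cat // eqxx /= eqseq_cons eqxx /= => /eqP.
exfalso; apply: (Hab (size u1).+1) => //.
have e1 : alt a b (size u1).+1 = rcons u1 c.
  have : take (size u1).+1 (alt a b n.+1) = rcons u1 c.
    by rewrite eu2 -cat_rcons take_size_cat // size_rcons.
  move=> <-; have -> : n.+1 = (size u1).+1 + (n - size u1) by lia.
  by rewrite take_alt.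
have e2 : alt a b (size u1) = u1.
  by move: e1; rewrite alt_rcons => /rcons_inj[].
rewrite e1 [alt b a _]/= e2 -wequiv_rconsl rcons_cons.
move: eb; rewrite eu2 {2}ex -cat_rcons -catA -cat_cons.
by rewrite wequiv_cat2r.
Qed.

End Group.

(** * Traces and recognizable sets *)

Section Traces.
Variables (S : finType) (m : S -> S -> nat).
Implicit Types (s t : S) (u v w x y : seq S).
Local Notation "u =c v" := (cequiv m u v) (at level 70).

#[local] Hint Resolve ce_refl : core.

#[local] Instance cequiv_equivalence : Equivalence (cequiv m).
Proof.
by split; [exact: ce_refl | move=> ? ? /ce_sym | exact: ce_trans].
Qed.

Lemma cequiv_ctx a b u v : u =c v -> a ++ u ++ b =c a ++ v ++ b.
Proof.
elim=> {u v} // [u v _ ->//|u v w _ -> _ ->//|c d s t st mst].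
have := ce_swap (a ++ c) (d ++ b) st mst.
by rewrite -!catA.
Qed.

#[local] Instance cat_cequiv :
  Proper (cequiv m ==> cequiv m ==> cequiv m) (@cat S).
Proof.
move=> u u' uu' v v' vv'; apply: (ce_trans (v := u' ++ v)).
  exact: (@cequiv_ctx [::] v).
by move: (cequiv_ctx u' [::] vv'); rewrite !cats0.
Qed.

#[local] Instance cons_cequiv :
  Proper (eq ==> cequiv m ==> cequiv m) (@cons S).
Proof. by move=> s _ <- u v uv; rewrite -(cat1s s u) -(cat1s s v) uv. Qed.

Lemma cequiv_perm u v : u =c v -> perm_eq u v.
Proof.
elim=> {u v} // [u v _|u v w _ uv _|a b s t _ _]; first by rewrite perm_sym.
  exact: perm_trans.
by rewrite perm_cat2l perm_cat2r (perm_catC [:: s] [:: t]).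
Qed.

Lemma cequiv_size u v : u =c v -> size u = size v.
Proof. by move/cequiv_perm/perm_size. Qed.

Lemma cequiv_nil u : u =c [::] -> u = [::].
Proof. by move/cequiv_size/size0nil. Qed.

(** * Factorisations of traces and Levi's lemma *)

Definition indep s t := (s != t) && (m s t == 2).

Lemma cequiv_swap a b s t : indep s t -> a ++ s :: t :: b =c a ++ t :: s :: b.
Proof. by case/andP=> st /eqP; exact: (@ce_swap _ _ a b). Qed.

Lemma cequiv_cons_rcons s u : all (indep s) u -> s :: u =c rcons u s.
Proof.
elim: u => //= t u IH /andP[st /IH us].
by apply: ce_trans (cequiv_swap [::] u st) _; rewrite /= us.
Qed.

Lemma cequiv_catC x y : allrel indep x y -> x ++ y =c y ++ x.
Proof.
elim: x => [|s x IH]; first by rewrite cats0.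
rewrite allrel_consl => /andP[sy /IH /= ->].
by rewrite -cat_cons (cequiv_cons_rcons sy) cat_rcons.
Qed.

(* A factorisation [w = x y] in the trace monoid is encoded by labelling each
   letter of the word [w] by [true] (it goes to [x]) or [false] (to [y]). *)
Definition part (b : bool) (z : seq (S * bool)) := [seq p.1 | p <- z & p.2 == b].

(** With [p] standing before [q]: a letter of the right factor has to move past each later letter of
    the left factor. *)
Definition label_ok (p q : S * bool) := (~~ p.2 && q.2) ==> indep p.1 q.1.

Lemma part_cat b z1 z2 : part b (z1 ++ z2) = part b z1 ++ part b z2.
Proof. by rewrite /part filter_cat map_cat. Qed.

Lemma part_label b c x : part b [seq (a, c) | a <- x] = if c == b then x else [::].
Proof.
elim: x => [|a x IH]; rewrite /part /= ?if_same //.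
by move: IH; rewrite /part; case: eqP => //= _ ->.
Qed.

Lemma cequiv_part z : pairwise label_ok z ->
  unzip1 z =c part true z ++ part false z.
Proof.
elim: z => //= [[s b] z] IH /andP[sz /IH ->]; case: b sz => sz //=.
rewrite -[X in _ =c X]cat_rcons -cat_cons -(@cequiv_cons_rcons s) //.
by rewrite all_map all_filter; apply: sub_all sz => -[t []].
Qed.

Definition factors w x y := exists z : seq (S * bool),
  [/\ unzip1 z = w, pairwise label_ok z, part true z =c x & part false z =c y].

Lemma unzip1_cat_inv (T : Type) (z : seq (S * T)) u v : unzip1 z = u ++ v ->
  exists z1 z2, [/\ z = z1 ++ z2, unzip1 z1 = u & unzip1 z2 = v].
Proof.
move=> e; exists (take (size u) z), (drop (size u) z); rewrite cat_take_drop.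
rewrite /unzip1 map_take map_drop -/(unzip1 z) e.
by rewrite take_size_cat ?drop_size_cat.
Qed.

Hypothesis m_sym : forall s t, m s t = m t s.

Lemma indep_sym s t : indep s t = indep t s.
Proof. by rewrite /indep eq_sym m_sym. Qed.

(** The labels travel with their letters; the only new constraint concerns the swapped pair, which
    commutes. *)
Lemma factors_swap a b s t x y : indep s t ->
  factors (a ++ s :: t :: b) x y -> factors (a ++ t :: s :: b) x y.
Proof.
move=> st [z [/unzip1_cat_inv[z1 [z2 [-> za]]]]].
case: z2 => //= -[s' bs] [//|[t' bt] z2] /= [-> -> zb] ok zx zy.
exists (z1 ++ (t, bt) :: (s, bs) :: z2); split.
- by rewrite /unzip1 map_cat /= -/unzip1 za zb.
- move: ok; rewrite !pairwise_cat !allrel_consr /= -!andbA.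
  move=> /and5P[-> -> -> -> /and4P[_ -> -> ->]] /=.
  by rewrite andbT /label_ok /= indep_sym st implybT.
- rewrite -zx !part_cat; case: bs bt {ok zx zy} => -[] //.
  exact/cequiv_swap/(etrans (indep_sym _ _)).
- rewrite -zy !part_cat; case: bs bt {ok zx zy} => -[] //.
  exact/cequiv_swap/(etrans (indep_sym _ _)).
Qed.

Lemma cequiv_factors w w' x y : w =c w' -> factors w x y <-> factors w' x y.
Proof.
elim=> {w w'} // [w w' _ -> //|w w' w'' _ -> _ //|a b s t st mst].
have st_indep : indep s t by rewrite /indep st mst.
by split; apply: factors_swap; rewrite // indep_sym.
Qed.

Lemma cat_factors x y : factors (x ++ y) x y.
Proof.
exists ([seq (a, true) | a <- x] ++ [seq (a, false) | a <- y]); split.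
- by rewrite /unzip1 map_cat -!map_comp !map_id.
- rewrite pairwise_cat !pairwise_map; apply/and3P; split.
  + by apply/allrelP => _ _ /mapP[a _ ->] /mapP[b _ ->].
  + by elim: x => //= a x ->; rewrite andbT; apply/allP.
  + by elim: y => //= a y ->; rewrite andbT; apply/allP.
- by rewrite part_cat !part_label cats0.
- by rewrite part_cat !part_label.
Qed.

(** The obvious labelling of [x ++ y] is transported along the commutations to [u ++ v] and cut
    after [u]. Letters of [y1] precede those of [x2], hence the independence. *)
Lemma levi u v x y : u ++ v =c x ++ y -> exists x1 y1 x2 y2,
  [/\ u =c x1 ++ y1, v =c x2 ++ y2, x1 ++ x2 =c x, y1 ++ y2 =c y
    & allrel indep y1 x2].
Proof.
move=> e; have /(cequiv_factors x y e)[z [zuv ok zx zy]] := cat_factors x y.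
have [z1 [z2 [ez <- <-]]] := unzip1_cat_inv zuv.
move: ok zx zy; rewrite ez pairwise_cat !part_cat => /and3P[ok12 ok1 ok2] zx zy.
exists (part true z1), (part false z1), (part true z2), (part false z2).
split; rewrite ?cequiv_part //.
apply/allrelP => _ _ /mapP[p + ->] /mapP[q + ->].
rewrite !mem_filter => /andP[/eqP p2 pz] /andP[/eqP q2 qz].
by have /allrelP /(_ p q pz qz) := ok12; rewrite /label_ok p2 q2.
Qed.

Lemma levi_inv x1 y1 x2 y2 : allrel indep y1 x2 ->
  (x1 ++ y1) ++ (x2 ++ y2) =c (x1 ++ x2) ++ (y1 ++ y2).
Proof.
by move=> ind; rewrite -!catA (catA y1) (cequiv_catC ind) -!catA.
Qed.

Lemma cequiv_cons_inj s u v : s :: u =c s :: v -> u =c v.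
Proof.
move/(@levi [:: s] u [:: s] v) => [x1 [y1 [x2 [y2 [e1 -> e2 <- ind]]]]].
case: x1 e1 e2 => [|a x1] e1 e2; last first.
  have := cequiv_size e1; have := cequiv_size e2; rewrite /= !size_cat /=.
  case: x1 {e1} e2 => [|? ?] //= e2; case: x2 {ind} e2 => [|? ?] //= e2 _.
  by case: y1.
(* With [x1] empty, [s] lies in both [y1] and [x2], so it would be independent of itself. *)
have /cequiv_perm /perm_mem y1s := e1; have /cequiv_perm /perm_mem x2s := e2.
have /allrelP /(_ s s) := ind; rewrite -y1s /= x2s mem_seq1 eqxx.
by move=> /(_ isT isT) /andP[/eqP].
Qed.

(** * Congruences of finite index and closure properties of recognizable sets *)

Definition fin_cong (N : finType) (phi : seq S -> N) : Prop :=
  (forall u v, u =c v -> phi u = phi v) /\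
  (forall u u' v v', phi u = phi u' -> phi v = phi v' ->
     phi (u ++ v) = phi (u' ++ v')).

Definition saturates (N : Type) (phi : seq S -> N) (L : seq S -> Prop) : Prop :=
  forall u v, phi u = phi v -> L u -> L v.

Definition recognizable (L : seq S -> Prop) : Prop :=
  exists (N : finType) (phi : seq S -> N), fin_cong phi /\ saturates phi L.

Lemma fin_cong_pair (N N' : finType) (phi : seq S -> N) (psi : seq S -> N') :
  fin_cong phi -> fin_cong psi -> fin_cong (fun u => (phi u, psi u)).
Proof.
move=> [phi1 phi2] [psi1 psi2]; split=> [u v uv|u u' v v' [e1 e2] [e3 e4]].
  by rewrite (phi1 _ _ uv) (psi1 _ _ uv).
by rewrite (phi2 _ _ _ _ e1 e3) (psi2 _ _ _ _ e2 e4).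
Qed.

Definition alphabet u : {set S} := [set a in u].

Lemma fin_cong_alphabet : fin_cong alphabet.
Proof.
split=> [u v /cequiv_perm /perm_mem uv|u u' v v' /setP eu /setP ev].
  by apply/setP => a; rewrite !inE uv.
by apply/setP => a; move: (eu a) (ev a); rewrite !inE !mem_cat => -> ->.
Qed.

(** Length truncated at 2 separates length 1 from all others; with the alphabet this recognizes
    single letters. *)
Lemma fin_cong_size : fin_cong (fun u => inord (minn (size u) 2) : 'I_3).
Proof.
have sizeE u v : (inord (minn (size u) 2) : 'I_3) = inord (minn (size v) 2) <->
    minn (size u) 2 = minn (size v) 2.
  split=> [/(congr1 val) /=|-> //]; rewrite !inordK //; lia.
split=> [u v /cequiv_size -> //|u u' v v' /sizeE eu /sizeE ev].
by apply/sizeE; rewrite !size_cat; lia.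
Qed.

Definition splits (N : finType) (phi : seq S -> N) u : {set N * N} :=
  [set p | `[< exists x y, u =c x ++ y /\ p = (phi x, phi y) >]].

Lemma allrel_alphabet x y x' y' : alphabet x = alphabet x' ->
  alphabet y = alphabet y' -> allrel indep x y -> allrel indep x' y'.
Proof.
move=> /setP ex /setP ey /allrelP ind; apply/allrelP => a b ax by'.
by apply: ind; [move: (ex a) | move: (ey b)]; rewrite !inE => ->.
Qed.

(** By Levi, a factorisation of [u ++ v] comes from one of [u] and one of [v] whose inner parts
    [y1], [x2] commute. That condition depends on alphabets only, so it survives the passage to
    other representatives because [phi] determines the alphabet. *)
Lemma fin_cong_splits (N : finType) (phi : seq S -> N) :
  fin_cong phi -> (forall u v, phi u = phi v -> alphabet u = alphabet v) ->
  fin_cong (splits phi).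
Proof.
move=> [phi1 phi2] phiA; split=> [u v uv|].
  apply/setP => p; rewrite !inE; apply: asbool_equiv_eq.
  by split=> -[x [y [e ->]]]; exists x, y; [rewrite -uv | rewrite uv].
suff sub u u' v v' : splits phi u = splits phi u' ->
    splits phi v = splits phi v' -> splits phi (u ++ v) \subset splits phi (u' ++ v').
  by move=> u u' v v' eu ev; apply/eqP; rewrite eqEsubset !sub.
move=> /setP eu /setP ev; apply/subsetP => p; rewrite !inE.
move=> /asboolP[x [y [/levi[x1 [y1 [x2 [y2 [e1 e2 ex ey ind]]]]] ->]]].
have := eu (phi x1, phi y1); rewrite !inE asboolT; last by exists x1, y1.
move=> /esym/asboolP[x1' [y1' [e1' [ex1 ey1]]]].
have := ev (phi x2, phi y2); rewrite !inE asboolT; last by exists x2, y2.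
move=> /esym/asboolP[x2' [y2' [e2' [ex2 ey2]]]].
apply/asboolP; exists (x1' ++ x2'), (y1' ++ y2'); split.
  by rewrite e1' e2' levi_inv //; apply: allrel_alphabet ind; exact: phiA.
by congr (_, _); [rewrite -(phi1 _ _ ex) | rewrite -(phi1 _ _ ey)]; exact: phi2.
Qed.

(** Common source of closure under products and under [xy |-> yx]; the alphabet is adjoined to [phi]
    to meet the hypothesis of [fin_cong_splits]. *)
Lemma recognizable_split (N : finType) (phi : seq S -> N)
    (P : seq S -> seq S -> Prop) : fin_cong phi ->
  (forall x y x' y', phi x = phi x' -> phi y = phi y' -> P x y -> P x' y') ->
  recognizable (fun u => exists x y, u =c x ++ y /\ P x y).
Proof.
move=> phiC HP; exists _, (splits (fun u => (phi u, alphabet u))); split.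
  by apply: fin_cong_splits => [|u v [] //]; exact/fin_cong_pair/fin_cong_alphabet.
move=> u v /setP e [x [y [uxy Pxy]]].
have := e ((phi x, alphabet x), (phi y, alphabet y)); rewrite !inE asboolT.
  move=> /esym/asboolP[x' [y' [vxy [ex _ ey _]]]].
  by exists x', y'; split=> //; exact: HP Pxy.
by exists x, y.
Qed.

Lemma recognizable_prod L1 L2 : recognizable L1 -> recognizable L2 ->
  recognizable (fun u => exists x y, u =c x ++ y /\ (L1 x /\ L2 y)).
Proof.
move=> [N1 [phi1 [C1 S1]]] [N2 [phi2 [C2 S2]]].
apply: (@recognizable_split _ _ (fun x y => L1 x /\ L2 y) (fin_cong_pair C1 C2)).
move=> x y x' y' [ex _] [_ ey] [Lx Ly].
by split; [exact: S1 Lx | exact: S2 Ly].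
Qed.

Lemma recognizable_conj L : recognizable L ->
  recognizable (fun u => exists x y, u =c x ++ y /\ L (y ++ x)).
Proof.
move=> [N [phi [C satL]]].
apply: (@recognizable_split _ _ (fun x y => L (y ++ x)) C).
by move=> x y x' y' ex ey; apply: satL; apply: C.2.
Qed.

Lemma recognizableT : recognizable (fun _ => True).
Proof. by exists unit, (fun _ => tt). Qed.

Lemma recognizable_not L : recognizable L -> recognizable (fun u => ~ L u).
Proof.
move=> [N [phi [C satL]]]; exists N, phi; split=> // u v e nLu Lv.
by apply: nLu; apply: satL Lv.
Qed.

Lemma recognizable_iff L L' :
  (forall u, L u <-> L' u) -> recognizable L -> recognizable L'.
Proof.
move=> LL' [N [phi [C satL]]]; exists N, phi; split=> // u v e /LL' Lu.
by apply/LL'; exact: satL Lu.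
Qed.

Lemma recognizable_letter s : recognizable (fun u => u = [:: s]).
Proof.
eexists _, _; split; first exact: (fin_cong_pair fin_cong_size fin_cong_alphabet).
move=> u v [+ +] eu; rewrite {u}eu => /(congr1 val) /=.
rewrite !inordK ?ltnS ?geq_minr //= => ev /setP/(_ s).
have {ev} : size v = 1 by move: ev; lia.
rewrite !inE eqxx; case: v => [|t [|? v]] //= _.
by rewrite mem_seq1 => /esym/eqP ->.
Qed.

Lemma recognizable_cons s L : recognizable L ->
  recognizable (fun u => exists y, u =c s :: y /\ L y).
Proof.
move=> RL; apply: recognizable_iff (recognizable_prod (recognizable_letter s) RL).
move=> u; split=> [[x [y [uy [ex Ly]]]]|[y [uy Ly]]]; last by exists [:: s], y.
by exists y; rewrite uy ex.
Qed.

Lemma recognizable_prefix f : recognizable (fun u => exists q, u =c f ++ q).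
Proof.
elim: f => [|s f IH].
  by apply: recognizable_iff recognizableT => u; split=> // _; exists u.
apply: recognizable_iff (recognizable_cons s IH) => u.
split=> [[y [uy [q yq]]]|[q uq]]; first by exists q; rewrite uy yq.
by exists (f ++ q); split=> //; exists q.
Qed.

Lemma recognizable_factor f : recognizable (fun u => exists p q, u =c p ++ f ++ q).
Proof.
apply: recognizable_iff (recognizable_prod recognizableT (recognizable_prefix f)).
move=> u; split=> [[x [y [uxy [_ [q yq]]]]]|[p [q e]]].
  by exists x, q; rewrite uxy yq.
by exists p, (f ++ q); split=> //; split=> //; exists q.
Qed.

Lemma recognizable_family (I : eqType) (l : seq I) (L : I -> seq S -> Prop) :
  (forall i, recognizable (L i)) -> exists (N : finType) (phi : seq S -> N),
  fin_cong phi /\ forall i, i \in l -> saturates phi (L i).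
Proof.
move=> RL; elim: l => [|i l [N [phi [C sat]]]].
  by have [N [phi [C _]]] := recognizableT; exists N, phi.
have [N' [psi [C' sat']]] := RL i.
eexists _, _; split; first exact: (fin_cong_pair C C').
move=> j; rewrite inE => /predU1P[-> | /sat satj] u v [e e'].
  exact: sat'.
exact: satj.
Qed.

Lemma recognizable_exists (I : eqType) (l : seq I) (L : I -> seq S -> Prop) :
  (forall i, recognizable (L i)) ->
  recognizable (fun u => exists2 i, i \in l & L i u).
Proof.
move=> /(recognizable_family l)[N [phi [C sat]]]; exists N, phi; split=> //.
by move=> u v e [i il Liu]; exists i => //; apply: sat Liu.
Qed.

End Traces.

(** * Fully commutative elements *)

Section FullyCommutative.
Variables (S : finType) (m : S -> S -> nat).
Hypothesis m_sym : forall s t, m s t = m t s.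
Implicit Types (s t : S) (u v w x y : seq S).
Local Notation "u =w v" := (wequiv m u v) (at level 70).
Local Notation "u =c v" := (cequiv m u v) (at level 70).
Local Notation reduced := (reduced m).
Local Notation braid_order := (braid_order m).

#[local] Existing Instances wequiv_equivalence cat_wequiv cons_wequiv.
#[local] Existing Instances cequiv_equivalence cat_cequiv cons_cequiv.
#[local] Hint Resolve we_refl ce_refl : core.

Lemma cequiv_wequiv u v : u =c v -> u =w v.
Proof.
elim=> {u v} // [u v _ ->//|u v w _ -> _ ->//|a b s t st mst].
by apply: we_ctx; have := @we_braid _ m s t st; rewrite mst; apply.
Qed.

Lemma reduced_cequiv u v : u =c v -> reduced u -> reduced v.
Proof.
by move=> uv red; apply: reduced_eqsize red (cequiv_wequiv uv) (cequiv_size uv).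
Qed.

(* When [m s t = 2] the relation [st = ts] does not obstruct full
   commutativity, but a collapse [s = t] in the group would. *)
Definition bad_pair (p : S * S) := [&& p.1 != p.2, 0 < braid_order p.1 p.2
  & (m p.1 p.2 != 2) || (braid_order p.1 p.2 != 2)].

Definition bad_words : seq (seq S) :=
  [seq [:: s; s] | s <- enum S] ++
  [seq alt p.1 p.2 (braid_order p.1 p.2) | p <- enum (bad_pair : pred (S * S))].

Definition bad u : Prop :=
  exists2 f, f \in bad_words & exists p q, u =c p ++ f ++ q.

Lemma bad_square p s q : bad (p ++ s :: s :: q).
Proof.
exists [:: s; s]; last by exists p, q.
by rewrite mem_cat; apply/orP; left; apply/mapP; exists s; rewrite ?mem_enum.
Qed.

Lemma bad_braid s t q : bad_pair (s, t) -> bad (alt s t (braid_order s t) ++ q).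
Proof.
move=> st; exists (alt s t (braid_order s t)); last by exists [::], q.
by rewrite mem_cat orbC (map_f _ (x := (s, t))) ?mem_enum.
Qed.

Lemma bad_cequiv u v : u =c v -> bad u -> bad v.
Proof. by move=> uv [f fbad [p [q e]]]; exists f => //; exists p, q; rewrite -uv. Qed.

Lemma bad_cons s u : bad u -> bad (s :: u).
Proof. by move=> [f fbad [p [q e]]]; exists f => //; exists (s :: p), q; rewrite e. Qed.

(** A commutation never exchanges [s] with [t], so the projection to these two letters is an
    invariant that tells the sides of a braid apart. *)
Lemma cequiv_filter s t u v : m s t != 2 -> u =c v ->
  filter (pred2 s t) u = filter (pred2 s t) v.
Proof.
move=> mst; elim=> {u v} // [u v w _ -> _ ->//|a b x y xy mxy].
rewrite !filter_cat /=; congr (_ ++ (_ ++ _)).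
case: (boolP ((x == s) || _)) => // xst; case: (boolP ((y == s) || _)) => // yst.
case/negP: mst; case/orP: xst yst mxy xy => /eqP-> /orP[]/eqP->.
all: by rewrite ?eqxx // => e _; rewrite ?e // m_sym e.
Qed.

Lemma FC_good u : reduced u -> FC m u -> ~ bad u.
Proof.
move=> red fc [f + [p [q e]]]; rewrite mem_cat => /orP[/mapP[s _ ef]|/mapP[[s t]]].
  have := red (p ++ q); rewrite (cequiv_size e) !size_cat ef /=.
  have uw : u =w p ++ q by rewrite (cequiv_wequiv e) ef /= wequiv_invol.
  by move=> /(_ uw); lia.
rewrite mem_enum /bad_pair => /and3P[/= st d0 mst] ef.
have ew : p ++ f ++ q =w p ++ alt t s (braid_order s t) ++ q.
  by rewrite ef (braid_order_braid d0).
have ec : p ++ f ++ q =c p ++ alt t s (braid_order s t) ++ q.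
  have red1 := reduced_cequiv e red.
  apply: fc => //; first last.
  - by rewrite (cequiv_wequiv e).
  - by rewrite (cequiv_wequiv e).
  - by apply: (reduced_eqsize red1 ew); rewrite ef !size_cat !size_alt.
(* If [m s t] is not 2, the projections differ at the first letter of the braid. If it is 2, the
   order is at most 2 and not 2, hence 1, and the two words contain different numbers of [s]. *)
have [mst2|mst2] := eqVneq (m s t) 2; last first.
  have := cequiv_filter mst2 ec; rewrite !filter_cat => /eqP.
  rewrite eqseq_cat // eqxx /= ef; case: braid_order d0 => //= n _.
  by rewrite !eqxx /= orbT /= eqseq_cons (negPf st).
have st2 : alt s t 2 =w alt t s 2 by have := @we_braid _ m s t st; rewrite mst2; apply.
have [_ d2 _] := braid_orderP (n := 2) isT st2.
have /cequiv_perm := ec; rewrite perm_cat2l perm_cat2r ef.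
have -> : braid_order s t = 1 by move: mst; rewrite mst2 /=; lia.
by move=> /perm_mem/(_ s); rewrite !inE eqxx (negPf st).
Qed.

(** Both claims go through one induction on length, since reducedness of [s :: u] uses uniqueness
    for [u]. *)
Lemma good_reduced_unique n u : size u = n -> ~ bad u ->
  reduced u /\ forall v, u =w v -> reduced v -> u =c v.
Proof.
elim: n u => [|n IH] u.
  move=> /size0nil -> _; split=> // v /we_sym uv /(_ _ uv).
  by rewrite leqn0 => /nilP ->.
case: u => //= s u [su] good.
have good_u : ~ bad u by move=> /(bad_cons s).
have [red_u uniq_u] := IH u su good_u.
have red_su : reduced (s :: u).
  (* Exchange gives [u] a reduced word starting with [s]. By uniqueness it is reached by
     commutations, so [s :: u] exhibits a square. *)
  case: (pselect (reduced (s :: u))) => // nred; case: good.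
  have [u1 [c [u2 [eu /wequiv_consl e]]]] := exchange red_u nred.
  have /(uniq_u _ e) : reduced (s :: u1 ++ u2).
    by apply: (reduced_eqsize red_u e); rewrite eu /= !size_cat /= addnS.
  move=> euc; apply: (bad_cequiv (u := [::] ++ s :: s :: (u1 ++ u2))).
    by rewrite euc.
  exact: bad_square.
split=> // -[|t v] uv red_v; first by have := red_su _ uv.
have sv : size u = size v.
  by have := red_su _ uv; have := red_v _ (we_sym uv) => /=; lia.
have [est|st] := eqVneq s t.
  rewrite {}est in uv *; move: uv => /wequiv_cons2 uv.
  by rewrite (uniq_u _ uv (reduced_cons red_v)).
set d := braid_order s t.
(* For infinite order the alternating prefix could be made longer than the word itself; for finite
   order it reaches length [d], and may then start with [s]. *)
have [/eqP d0|d0] := posnP d.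
  have [q q0 /(braid_orderP (proj1 (andP q0)))[]|x [_]] :=
    descents_alt (n := size (s :: u)) red_su (we_refl _ _) erefl uv (congr1 succn sv).
    by rewrite -/d (eqP d0).
  by lia.
have [q /andP[q0 qd] /(braid_orderP q0)[_]|x [ex sx]] :=
    descents_alt (n := d.-1) red_su (we_refl _ _) erefl uv (congr1 succn sv).
  by rewrite -/d; lia.
rewrite prednK // in ex sx.
have {ex} ex : s :: u =w alt s t d ++ x.
  by case: ex => // ->; rewrite -(braid_order_braid d0).
have red_x : reduced (alt s t d ++ x).
  by apply: (reduced_eqsize red_su ex); rewrite sx size_cat size_alt.
have euc : s :: u =c alt s t d ++ x.
  move: ex red_x; rewrite -(prednK d0) /= => /wequiv_cons2 ex /reduced_cons red_x.
  by rewrite (uniq_u _ ex red_x).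
(* The braid prefix is reached by commutations, so goodness leaves only [m s t = 2] and [d = 2].
   Then [t] moves to the front, and induction applies to the rest. *)
have : ~~ bad_pair (s, t).
  apply/negP => /(@bad_braid _ _ x) badx; apply: good.
  by apply: bad_cequiv badx; symmetry.
rewrite /bad_pair /= -/d st d0 /= negb_or !negbK => /andP[mst /eqP d2].
rewrite {}d2 /= in euc ex red_x sx.
have ts : s :: t :: x =c t :: s :: x by apply: (@ce_swap _ _ [::]) => //; apply/eqP.
have good_x : ~ bad (s :: x).
  by move=> /(bad_cons t) b; apply: good; apply: bad_cequiv b; rewrite euc ts.
have sx' : size (s :: x) = n by move: sx => /=; lia.
have [_ uniq_x] := IH (s :: x) sx' good_x.
rewrite euc ts (uniq_x v) //; last exact: reduced_cons red_v.
by rewrite -(wequiv_cons2 _ t) -uv ex (cequiv_wequiv ts).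
Qed.

Lemma reduced_FC_good u : (reduced u /\ FC m u) <-> ~ bad u.
Proof.
split=> [[]|good]; first exact: FC_good.
have [red uniq_u] := good_reduced_unique erefl good.
by split=> // v1 v2 red1 red2 e1 e2; rewrite -(uniq_u v1) // -(uniq_u v2).
Qed.

(** * Cyclic shifts of traces *)

Definition cyc_good u : Prop := ~ exists x y, u =c x ++ y /\ bad (y ++ x).

Lemma cyc_good_cequiv u v : u =c v -> cyc_good u -> cyc_good v.
Proof. by move=> uv gu [x [y [e b]]]; apply: gu; exists x, y; rewrite uv. Qed.

Lemma cyc_good_good u : cyc_good u -> ~ bad u.
Proof. by move=> gu b; apply: gu; exists [::], u; rewrite cats0. Qed.

(** Full commutativity makes the reduced words of the element one commutation class, so rotating
    these words at all positions amounts to rotating all trace factorisations. *)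
Lemma CFC_cyc_good u : (reduced u /\ CFC m u) <-> cyc_good u.
Proof.
split=> [[red cfc] [x [y [e b]]]|gu].
  have red' := reduced_cequiv e red.
  have := cfc _ red' (cequiv_wequiv e) (size x).
  by rewrite rot_size_cat => /reduced_FC_good.
have /reduced_FC_good[red fc] := cyc_good_good gu; split=> // v redv uv k.
have uvc : u =c v by apply: fc.
apply/reduced_FC_good => b; apply: gu; exists (take k v), (drop k v).
by rewrite cat_take_drop.
Qed.

Lemma recognizable_cyc_good : recognizable m cyc_good.
Proof.
apply/recognizable_not/(recognizable_conj m_sym)/recognizable_exists => f.
exact: recognizable_factor.
Qed.

Lemma cyc_good_wequiv u v : cyc_good u -> cyc_good v -> u =w v -> u =c v.
Proof.
move=> /cyc_good_good/reduced_FC_good[red fc].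
by move=> /cyc_good_good/reduced_FC_good[redv _] uv; apply: fc.
Qed.

(** * Normal forms of traces *)

Definition first_letter u : option S :=
  [pick a | `[< exists v, u =c a :: v >]].

(** [pick] depends only on the set of possible first letters, and this set is an invariant of the
    trace. *)
Lemma first_letter_cequiv u v : u =c v -> first_letter u = first_letter v.
Proof.
move=> uv; apply: eq_pick => a; apply: asbool_equiv_eq.
by split=> -[w e]; exists w; [rewrite -uv | rewrite uv].
Qed.

Fixpoint normal u : bool :=
  if u is a :: u' then (first_letter u == Some a) && normal u' else true.

Lemma normal_exists u : exists2 v, u =c v & normal v.
Proof.
move: {-1}(size u) (erefl (size u)) => n; elim: n u => [|n IH] u su.
  by exists [::]; rewrite // (size0nil su).
have [a [u' e fa]] : exists a, exists2 u', u =c a :: u' & first_letter u = Some a.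
  rewrite /first_letter; case: pickP => [a /asboolP[u' e]|no]; first by exists a, u'.
  by case: u su no => // a u' _ /(_ a)/negP[]; apply/asboolP; exists u'.
have [|v e' nv] := IH u'; first by have := cequiv_size e; rewrite su => -[].
exists (a :: v); first by rewrite e e'.
rewrite /= nv andbT (@first_letter_cequiv _ u) ?fa //.
by rewrite e e'.
Qed.

Lemma normal_inj u v : u =c v -> normal u -> normal v -> u = v.
Proof.
elim: u v => [|a u IH] v uv; first by have := cequiv_nil (ce_sym uv) => ->.
case: v uv => [/cequiv_nil //|b v] uv /andP[/eqP fa nu] /andP[/eqP fb nv].
have ab : a = b by have := first_letter_cequiv uv; rewrite fa fb => -[].
rewrite -{}ab in uv *; rewrite (IH v) //; exact: cequiv_cons_inj uv.
Qed.

Lemma saturates_first_letter : exists (N : finType) (phi : seq S -> N),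
  fin_cong m phi /\ forall u v, phi u = phi v -> first_letter u = first_letter v.
Proof.
have R a : recognizable m (fun u => exists v, u =c a :: v).
  by apply: recognizable_iff (recognizable_prefix m_sym [:: a]).
have [N [phi [C sat]]] := recognizable_family (enum S) R.
exists N, phi; split=> // u v e; apply: eq_pick => a; apply: asbool_equiv_eq.
by split; apply: (sat a); rewrite ?mem_enum.
Qed.

(** Each CFC class contains exactly one normal word: between cyclically good words, equality in the
    group is commutation equivalence. *)
Lemma cfc_countE k :
  cfc_count m k = #|[set u : k.-tuple S | normal u && `[< cyc_good u >]]|.
Proof.
pose class (u : k.-tuple S) := [set v : k.-tuple S | `[< val u =w val v >]].
have classP (u v : k.-tuple S) : class u = class v -> val u =w val v.
  by move/setP/(_ v); rewrite !inE [RHS]asboolT // => /asboolP.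
rewrite /cfc_count -/class; set U := [set u | _]; set V := [set u | _].
have -> : [set class u | u in U] = [set class u | u in V].
  apply/setP => C; apply/imsetP/imsetP => -[u + ->]; rewrite inE.
    move=> /asboolP/CFC_cyc_good gu; have [v uv nv] := normal_exists u.
    have sv : size v == k by rewrite -(cequiv_size uv) size_tuple.
    exists (Tuple sv); first by rewrite inE nv; apply/asboolP/(cyc_good_cequiv uv).
    apply/setP => w; rewrite !inE; apply: asbool_equiv_eq.
    by rewrite /= (cequiv_wequiv uv).
  move=> /andP[_ /asboolP gu]; exists u => //.
  by rewrite inE; apply/asboolP/CFC_cyc_good.
rewrite card_in_imset // => u v; rewrite !inE.
move=> /andP[nu /asboolP gu] /andP[nv /asboolP gv] /classP uv.
by apply/val_inj/normal_inj => //; exact: cyc_good_wequiv.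
Qed.

End FullyCommutative.

(** * Transfer matrices *)

Section Rationality.
Local Open Scope ring_scope.

Definition rational_series (a : nat -> rat) : Prop :=
  exists P Q : {poly rat}, Q != 0 /\
    forall n : nat, \sum_(i < n.+1) Q`_i * a (n - i)%N = P`_n.

Lemma rational_recurrence (a : nat -> rat) (p : {poly rat}) d :
  size p = d.+1 -> (forall k, \sum_(i < d.+1) p`_i * a (k + i)%N = 0) ->
  rational_series a.
Proof.
(* [Q] is the reciprocal polynomial of [p]; its constant term is the leading coefficient of [p],
   hence nonzero. The recurrence kills the product from degree [d] on. *)
move=> sp rec; pose Q := \poly_(i < d.+1) p`_(d - i).
exists (\poly_(n < d) \sum_(i < n.+1) Q`_i * a (n - i)%N), Q; split.
  apply/negP => /eqP /(congr1 (fun q : {poly rat} => q`_0)).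
  rewrite coef_poly coef0 subn0 /= -[d]/(d.+1.-1) -sp => /eqP.
  by rewrite lead_coef_eq0 -size_poly_eq0 sp.
move=> n; rewrite coef_poly; case: ltnP => // dn.
rewrite (eq_bigr (fun i : 'I_n.+1 =>
  if (i < d.+1)%N then p`_(d - i) * a (n - i)%N else 0)); last first.
  by move=> i _; rewrite coef_poly; case: ifP; rewrite ?mul0r.
rewrite -big_mkcond /= -(big_ord_widen n.+1 (fun i => p`_(d - i) * a (n - i)%N)) //.
rewrite (reindex_inj rev_ord_inj) /= -[RHS](rec (n - d)%N).
apply: eq_bigr => i _; have := ltn_ord i => id; congr (p`_ _ * a _); lia.
Qed.

Lemma rational_mxpow q (c : 'rV[rat]_q.+1) (A : 'M_q.+1) (g : 'cV_q.+1) :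
  rational_series (fun k => (c *m A ^+ k *m g) 0 0).
Proof.
apply: (rational_recurrence (size_char_poly A)) => k.
transitivity ((c *m A ^+ k *m horner_mx A (char_poly A) *m g) 0 0); last first.
  by rewrite Cayley_Hamilton mulmx0 mul0mx mxE.
rewrite /horner_mx /horner_morph horner_coef.
rewrite (size_map_inj_poly (@fmorph_inj _ _ _)) ?rmorph0 //.
rewrite size_char_poly mulmx_sumr mulmx_suml summxE; apply: eq_bigr => i _.
rewrite coef_map /= -[_%:M * _]/(_%:M *m _) mul_scalar_mx -scalemxAr -scalemxAl.
by rewrite exprD -[A ^+ k * _]/(_ *m _) !mulmxA [RHS]mxE.
Qed.

(** [theta] is the state of an automaton reading words from the right: [c k] counts the words of
    length [k] by state, [A] prepends a letter, and [g] selects the accepting states. *)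
Lemma rational_count_ord (S : finType) q (theta : seq S -> 'I_q.+1)
    (K : pred (seq S)) :
  (forall a u v, theta u = theta v -> theta (a :: u) = theta (a :: v)) ->
  (forall u v, theta u = theta v -> K u = K v) ->
  rational_series (fun k => #|[set u : k.-tuple S | K u]|%:R).
Proof.
move=> thetaS thetaK.
(* States that no word attains get the dummy representative [[::]]; their entries in [c k] are
   zero. *)
have /choice[rep repE] n : exists v, forall u, theta u = n -> theta v = n.
  case: (pselect (exists v, theta v = n)) => [[v <-]|nex]; first by exists v.
  by exists [::] => u e; case: nex; exists u.
pose c k : 'rV[rat]_q.+1 := \sum_(u : k.-tuple S) delta_mx 0 (theta u).
pose A : 'M[rat]_q.+1 := \matrix_i \sum_a delta_mx 0 (theta (a :: rep i)).
pose g : 'cV[rat]_q.+1 := \col_i (K (rep i))%:R.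
have cS k : c k.+1 = c k *m A.
  rewrite mulmx_suml /c; under [RHS]eq_bigr => u _.
    rewrite -rowE rowK; under eq_bigr => a _.
      rewrite (thetaS a _ u) ?(repE _ u) //; over.
    over.
  rewrite exchange_big pair_big /=.
  rewrite (reindex (fun p : S * k.-tuple S => cons_tuple p.1 p.2)) //=.
  exists (fun u : k.+1.-tuple S => (thead u, behead_tuple u)) => [[a u] _|u _] /=.
    by congr (_, _); apply: val_inj.
  by rewrite [RHS]tuple_eta; apply: val_inj.
have ck k : c k = c 0%N *m A ^+ k.
  by elim: k => [|k IH]; rewrite ?mulmx1 // cS IH exprSr mulmxA.
have [P [Q [Q0 PQ]]] := rational_mxpow (c 0%N) A g.
exists P, Q; split=> // n; rewrite -PQ; apply: eq_bigr => i _; congr (_ * _).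
rewrite -ck mulmx_suml summxE -sum1_card natr_sum big_mkcond /=.
apply: eq_bigr => u _; rewrite -rowE !mxE inE (thetaK _ u) ?(repE _ u) //.
by case: (K u).
Qed.

Lemma rational_count (S N : finType) (theta : seq S -> N) (K : pred (seq S)) :
  (forall a u v, theta u = theta v -> theta (a :: u) = theta (a :: v)) ->
  (forall u v, theta u = theta v -> K u = K v) ->
  rational_series (fun k => #|[set u : k.-tuple S | K u]|%:R).
Proof.
move=> thetaS thetaK.
have [q eN] : exists q, #|N| = q.+1.
  by exists #|N|.-1; rewrite prednK //; apply/card_gt0P; exists (theta [::]).
pose f n : 'I_q.+1 := cast_ord eN (enum_rank n).
have f_inj : injective f by move=> ? ? /cast_ord_inj/enum_rank_inj.
apply: (@rational_count_ord S q (f \o theta)) => [a u v|u v] /f_inj.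
  by move/(thetaS a) => /= ->.
exact: thetaK.
Qed.

End Rationality.

Local Open Scope ring_scope.

(* The generating series sum_k |W^CFC_k| x^k is rational:
   Q(x) * W^CFC(x) = P(x) as formal power series, for polynomials P, Q
   over Q with Q <> 0. *)
Theorem theorem1 (S : finType) (m : S -> S -> nat) :
  coxeter_matrix m ->
  exists P Q : {poly rat}, Q != 0 /\
    forall n : nat,
      \sum_(i < n.+1) Q`_i * ((cfc_count m (n - i))%:R : rat) = P`_n.
Proof.
case=> m_sym _.
have [N1 [phi [[phi1 phi2] sat1]]] := recognizable_cyc_good m_sym.
have [N2 [psi [[psi1 psi2] sat2]]] := saturates_first_letter m_sym.
(* Normality of [a :: u] needs that of [u] and, through [psi], the first letter of [a :: u]; [phi]
   decides cyclic goodness. *)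
pose theta u := (normal m u, phi u, psi u).
pose K u := normal m u && `[< cyc_good m u >].
have [||P [Q [Q0 PQ]]] := @rational_count S _ theta K.
- move=> a u v [nu ephi epsi].
  have epsi' : psi (a :: u) = psi (a :: v) by apply: (psi2 [:: a] [:: a]).
  rewrite /theta /= nu (sat2 _ _ epsi') epsi'; congr (_, _, _).
  exact: (phi2 [:: a] [:: a]).
- move=> u v [nu ephi _]; rewrite /K nu; congr (_ && _).
  by apply: asbool_equiv_eq; split; apply: sat1.
exists P, Q; split=> // n; rewrite -PQ; apply: eq_bigr => i _.
by rewrite cfc_countE.
Qed.
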